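(* Let $p,q$ be relatively prime positive integers, let $[a_1,a_2,\ldots,a_n]=p/q$ be a positive continued fraction with $a_1>1$, and let $[b_1,b_2,\ldots,b_m]$ be an even continued fraction such that $[b_1,\ldots,b_m]=p/q$ or $[b_1,\ldots,b_m]=p/(p-q)$. Then the following snake graphs are isomorphic (as graphs): $$\mathcal G[a_1,a_2,\ldots,a_n]\cong\mathcal G[1,a_1-1,a_2,\ldots,a_n]\cong\mathcal G[b_1,b_2,\ldots,b_m].$$ In particular, the number of perfect matchings of $\mathcal G[b_1,\ldots,b_m]$ is equal to $p$.
   Context: $[c_1,\ldots,c_k]=c_1+1/(c_2+1/(\cdots+1/c_k))$; it is a positive continued fraction if all $c_i$ are positive integers, and an even continued fraction if all $c_i$ are nonzero even integers. A tile is a unit square with axis-parallel sides, regarded as a graph with 4 vertices and 4 edges. A snake graph is a connected planar graph consisting of a finite sequence of tiles $G_1,\ldots,G_d$ ($d\ge1$) such that $G_i$ and $G_{i+1}$ share exactly one edge $e_i$, which is either the north edge of $G_i$ and the south edge of $G_{i+1}$, or the east edge of $G_i$ and the west edge of $G_{i+1}$. A single edge with its two vertices is also a snake graph ($d=0$). The $e_1,\ldots,e_{d-1}$ are the interior edges. A sign function assigns $\pm$ to every edge so that on each tile the north and west edges have the same sign, the south and east edges have the same sign, and north and south have opposite signs. A snake graph is determined up to symmetry by its number of tiles and the sequence of signs of its interior edges $e_1,\ldots,e_{d-1}$ (and a global sign change of the sequence gives an isomorphic graph). Positive case: $\mathcal G[a_1,\ldots,a_n]$ is the snake graph with $d=a_1+\cdots+a_n-1$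 tiles whose interior edges have sign sequence consisting of $a_1-1$ signs $-\epsilon$, then $a_2$ signs $\epsilon$, then $a_3$ signs $-\epsilon$, …, then $a_n-1$ signs $\pm\epsilon$ (for $n=1$: $a_1-2$ equal signs; $\mathcal G[1]$ is a single edge). Even case: put $\epsilon_i=(-1)^{i+1}\operatorname{sgn}(b_i)$. $\mathcal G[b_1,\ldots,b_m]$ is obtained from the zigzag snake graphs $\mathcal G[|b_1|],\ldots,\mathcal G[|b_m|]$ (where $\mathcal G[|b_i|]$ has $|b_i|-1$ tiles and $|b_i|-2$ interior edges, all of sign $\epsilon_i$) by joining consecutive ones as follows: if $b_i,b_{i+1}$ have the same sign, one inserts a connecting tile between the last tile of $\mathcal G[|b_i|]$ and the first tile of $\mathcal G[|b_{i+1}|]$, which creates two new interior edges of signs $\epsilon_i,\epsilon_{i+1}$ in this order; if $b_i,b_{i+1}$ have opposite signs, one identifies an edge of the last tile of $\mathcal G[|b_i|]$ with an edge of the first tile of $\mathcal G[|b_{i+1}|]$, which creates one new interior edge of sign $-\epsilon_i$ (here $\epsilon_i=\epsilon_{i+1}$). *)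

(* Defs.v *)
From mathcomp Require Import all_boot all_order all_algebra.
From mathcomp Require Import finmap zify.

Set Implicit Arguments.
Unset Strict Implicit.
Unset Printing Implicit Defensive.

Import Order.TTheory GRing.Theory Num.Theory.
Local Open Scope fset_scope.
Local Open Scope ring_scope.

(** * Finite simple graphs *)

Record graph (K : choiceType) := Graph {
  vertices : {fset K};
  edges : {fset {fset K}};
  edges_wf : {in edges, forall e, #|` e| = 2%N /\ e `<=` vertices}
}.

Definition adjacent (K : choiceType) (G : graph K) (x y : vertices G) : bool :=
  [fset val x; val y] \in edges G.

Definition isomorphic (K L : choiceType) (G : graph K) (H : graph L) : Prop :=
  exists phi : vertices G -> vertices H,
    bijective phi /\ forall x y, adjacent (phi x) (phi y) = adjacent x y.

Definition perfect_matching (K : choiceType) (G : graph K)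
    (M : {fset {fset K}}) : bool :=
  (M `<=` edges G) &&
  [forall v : vertices G, #|` [fset e in M | val v \in e]| == 1%N].

Definition num_perfect_matchings (K : choiceType) (G : graph K) : nat :=
  #|` [fset M in fpowerset (edges G) | perfect_matching G M]|.

(** * Continued fractions *)

Fixpoint cfrac (c : seq int) : rat :=
  match c with
  | [::] => 0
  | [:: x] => x%:~R
  | x :: c' => x%:~R + (cfrac c')^-1
  end.

Definition positive_cf (a : seq nat) : bool :=
  (a != [::]) && all (fun x => 0 < x)%N a.

Definition even_cf (b : seq int) : bool :=
  (b != [::]) && all (fun x => (x != 0) && (2 %| x)%Z) b.

(** * Snake graphs *)

Notation point := (int * int)%type.
Notation edge := {fset point}.

(* A tile, i.e. a unit square of the integer grid, is encoded by its
   south-west corner. *)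
Notation tile := point.

Definition east_step : point := (1, 0).
Definition north_step : point := (0, 1).

Definition south (t : tile) : edge := [fset t; t + east_step].
Definition west (t : tile) : edge := [fset t; t + north_step].
Definition north (t : tile) : edge := south (t + north_step).
Definition east (t : tile) : edge := west (t + east_step).

Definition tile_edges (t : tile) : seq edge :=
  [:: south t; east t; north t; west t].

(* The next tile is glued along the east or the north edge of the previous
   one. The empty sequence of tiles encodes the single-edge snake graph. *)
Definition next_tile (t t' : tile) : bool :=
  (t' == t + east_step) || (t' == t + north_step).

Definition snake (ts : seq tile) : bool := sorted next_tile ts.

Definition snake_edges (ts : seq tile) : {fset edge} :=
  if ts is [::] then [fset south 0]
  else [fset e in flatten (map tile_edges ts)].

Definition snake_vertices (ts : seq tile) : {fset point} :=
  \bigcup_(e <- snake_edges ts) e.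

Lemma south_card t : #|` south t| = 2%N.
Proof.
rewrite cardfs2 /south; case: t => x y.
by rewrite -[X in X == _]addr0 (inj_eq (addrI _)).
Qed.

Lemma west_card t : #|` west t| = 2%N.
Proof.
rewrite cardfs2 /west; case: t => x y.
by rewrite -[X in X == _]addr0 (inj_eq (addrI _)).
Qed.

Lemma snake_graph_wf (ts : seq tile) :
  {in snake_edges ts, forall e, #|` e| = 2%N /\ e `<=` snake_vertices ts}.
Proof.
move=> e ets; split; last first.
  by apply/fsubsetP => x xe; apply/bigfcupP; exists e; rewrite ?ets.
case: ts ets => [|t ts]; first by rewrite /= inE => /eqP ->; apply: south_card.
rewrite in_fset => /flatten_mapP [u _].
by rewrite !inE => /or4P [] /eqP ->; rewrite ?south_card ?west_card.
Qed.

Definition snake_graph (ts : seq tile) : graph point :=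
  Graph (@snake_graph_wf ts).

Definition shared_edge (t t' : tile) : edge :=
  if t' == t + north_step then north t else east t.

Definition interior_edges (ts : seq tile) : seq edge :=
  if ts is t :: ts' then pairmap shared_edge t ts' else [::].

(* [true] is the sign +, [false] the sign -. *)
Definition sign_function (ts : seq tile) (f : edge -> bool) : Prop :=
  forall t, t \in ts ->
    [/\ f (north t) = f (west t), f (south t) = f (east t)
      & f (north t) = ~~ f (south t)].

(** ** Positive continued fractions *)

(* [alternating e [:: c_1; ...; c_k]] is c_1 signs e, c_2 signs -e, ...,
   with only c_k - 1 signs in the last block. *)
Fixpoint alternating (e : bool) (c : seq nat) : seq bool :=
  match c with
  | [::] => [::]
  | [:: x] => nseq (x - 1) e
  | x :: c' => nseq x e ++ alternating (~~ e) c'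
  end.

Definition positive_signs (eps : bool) (a : seq nat) : seq bool :=
  match a with
  | [::] => [::]
  | [:: x] => nseq (x - 2) (~~ eps)
  | x :: a' => nseq (x - 1) (~~ eps) ++ alternating eps a'
  end.

(* [ts] realizes G[a_1, ..., a_n]. *)
Definition positive_snake (a : seq nat) (ts : seq tile) : Prop :=
  [/\ snake ts,
      size ts = (sumn a - 1)%N
    & exists (f : edge -> bool) (eps : bool),
        sign_function ts f /\ map f (interior_edges ts) = positive_signs eps a].

(** ** Even continued fractions *)

(* The sign (-1)^(i+1) sgn(x). *)
Definition even_sign (i : nat) (x : int) : bool :=
  if odd i then 0 < x else x < 0.

Definition zigzag (f : edge -> bool) (e : bool) (k : nat) (ts : seq tile)
    : Prop :=
  size ts = (k - 1)%N /\ map f (interior_edges ts) = nseq (k - 2) e.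

(* [even_join f i [:: b_i; ...; b_m] ts]: under the sign function [f], the
   sequence [ts] is obtained by joining zigzags G[|b_i|], ..., G[|b_m|]. The
   default arguments of [last] and [head] are irrelevant, since |b_j| >= 2
   makes every zigzag nonempty. *)
Fixpoint even_join (f : edge -> bool) (i : nat) (b : seq int) (ts : seq tile)
    : Prop :=
  match b with
  | [::] => False
  | [:: x] => zigzag f (even_sign i x) `|x|%N ts
  | x :: (y :: _) as b' =>
      exists ts1 ts2 : seq tile,
      [/\ zigzag f (even_sign i x) `|x|%N ts1,
          even_join f i.+1 b' ts2
        & if (0 < x) == (0 < y) then
            exists t : tile,
            [/\ ts = ts1 ++ t :: ts2,
                f (shared_edge (last 0 ts1) t) = even_sign i x
              & f (shared_edge t (head 0 ts2)) = even_sign i.+1 y]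
          else
            ts = ts1 ++ ts2 /\
            f (shared_edge (last 0 ts1) (head 0 ts2)) = ~~ even_sign i x]
  end.

(* [ts] realizes G[b_1, ..., b_m]. *)
Definition even_snake (b : seq int) (ts : seq tile) : Prop :=
  snake ts /\
  exists f : edge -> bool, sign_function ts f /\ even_join f 1 b ts.

(** ** Every positive or even continued fraction has a snake graph *)

Lemma snake_signs_exist : exists f : edge -> bool,
  (forall ts, sign_function ts f) /\
  (forall t x, exists t', next_tile t t' /\ f (shared_edge t t') = x).
Proof.
pose par (t : point) := (2 %| t.1 + t.2)%Z.
pose f (e : edge) :=
  [exists v : e, (val v + north_step \in e) && par (val v)
              || (val v + east_step \in e) && ~~ par (val v)].
have fW t : f (west t) = par t.
  apply/existsP/idP => [[[v /= vW]]|pt].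
    move: (vW); rewrite /west !inE => /orP [] /eqP ->.
      by rewrite /par; case: t {vW} => x y; rewrite !xpair_eqE /=; lia.
    by rewrite /par; case: t {vW} => x y; rewrite !xpair_eqE /=; lia.
  have tW : t \in west t by rewrite !inE eqxx.
  by exists [` tW]; rewrite /= pt !inE eqxx orbT.
have fS t : f (south t) = ~~ par t.
  apply/existsP/idP => [[[v /= vS]]|pt].
    move: (vS); rewrite /south !inE => /orP [] /eqP ->.
      by rewrite /par; case: t {vS} => x y; rewrite !xpair_eqE /=; lia.
    by rewrite /par; case: t {vS} => x y; rewrite !xpair_eqE /=; lia.
  have tS : t \in south t by rewrite !inE eqxx.
  by exists [` tS]; rewrite /= pt !inE eqxx !orbT.
have pN t : par (t + north_step) = ~~ par t.
  by rewrite /par; case: t => x y /=; lia.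
have pE t : par (t + east_step) = ~~ par t.
  by rewrite /par; case: t => x y /=; lia.
exists f; split=> [ts t _|t x].
  by rewrite /north /east !fW !fS pN pE negbK.
have [->|xp] := eqVneq x (par t).
  exists (t + north_step); rewrite /next_tile /shared_edge !eqxx orbT.
  by rewrite /north fS pN negbK.
exists (t + east_step); rewrite /next_tile /shared_edge !eqxx.
rewrite (inj_eq (addrI t)) /= /east fW pE.
by split=> //; case: (par t) x xp => [] [].
Qed.

Lemma path_signs_exist (f : edge -> bool) :
  (forall t x, exists t', next_tile t t' /\ f (shared_edge t t') = x) ->
  forall s t, exists ts,
    path next_tile t ts /\ map f (pairmap shared_edge t ts) = s.
Proof.
move=> fstep; elim=> [|x s IHs] t; first by exists [::].
have [t' [tt' <-]] := fstep t x; have [ts [pts <-]] := IHs t'.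
by exists (t' :: ts); rewrite /= tt'.
Qed.

Lemma size_positive_signs eps a : positive_cf a ->
  size (positive_signs eps a) = (sumn a - 2)%N.
Proof.
case: a => [|x [|y a]] //=; first by rewrite size_nseq addn0.
move=> /and4P [_ x0 y0 a0].
have size_alt : forall a y e, (0 < y)%N -> all (fun x => 0 < x)%N a ->
    size (alternating e (y :: a)) = (sumn (y :: a) - 1)%N.
  elim=> [|z b IHb] u e u0; first by rewrite /= size_nseq addn0.
  move=> /andP [z0 b0]; have := IHb z (~~ e) z0 b0.
  by rewrite /= size_cat size_nseq => ->; lia.
by have := size_alt a y eps y0 a0; rewrite /= size_cat size_nseq => ->; lia.
Qed.

Lemma positive_snake_exists (a : seq nat) :
  positive_cf a -> exists ts, positive_snake a ts.
Proof.
move=> pa; have [f [fsign fstep]] := snake_signs_exist.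
have sz := size_positive_signs true pa.
have [a1|a1] := leqP (sumn a) 1.
  have s0 : positive_signs true a = [::] by apply: size0nil; lia.
  exists [::]; split=> //=; first by lia.
  by exists f, true; rewrite s0.
have [ts [pts fts]] := path_signs_exist fstep (positive_signs true a) 0.
exists (0 :: ts); split=> //=; last by exists f, true.
by move: sz; rewrite -fts size_map size_pairmap; lia.
Qed.

Lemma even_snake_exists (b : seq int) :
  even_cf b -> exists ts, even_snake b ts.
Proof.
case: b => // x b /and3P [_ x0 b0].
have [f [fsign fstep]] := snake_signs_exist.
suff [ts [pts jts]] : exists ts,
    path next_tile 0 ts /\ even_join f 1 (x :: b) (0 :: ts).
  by exists (0 :: ts); split=> //; exists f.
have zig u e t : (u != 0) && (2 %| u)%Z -> exists ts,
    path next_tile t ts /\ zigzag f e `|u|%N (t :: ts).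
  move=> u2; have [ts [pts fts]] := path_signs_exist fstep (nseq (`|u| - 2) e) t.
  exists ts; split=> //; split=> //=.
  by move: (congr1 size fts); rewrite size_map size_pairmap size_nseq; lia.
elim: b x x0 b0 1%N (0 : point) => [|y b IHb] x x2 b2 i t.
  by have [ts [pts zts]] := zig x (even_sign i x) t x2; exists ts.
move: b2 => /= /andP [y2 b2].
have [ts1 [p1 z1]] := zig x (even_sign i x) t x2.
case xy: ((0 < x) == (0 < y)).
  have [t1 [n1 f1]] := fstep (last t ts1) (even_sign i x).
  have [t2 [n2 f2]] := fstep t1 (even_sign i.+1 y).
  have [ts2 [p2 j2]] := IHb y y2 b2 i.+1 t2.
  exists (ts1 ++ [:: t1, t2 & ts2]); rewrite cat_path p1 /= n1 n2 p2; split=> //.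
  exists (t :: ts1), (t2 :: ts2); split=> //.
  by exists t1.
have [t2 [n2 f2]] := fstep (last t ts1) (~~ even_sign i x).
have [ts2 [p2 j2]] := IHb y y2 b2 i.+1 t2.
exists (ts1 ++ t2 :: ts2); rewrite cat_path p1 /= n2 p2; split=> //.
by exists (t :: ts1), (t2 :: ts2).
Qed.

(* Main.v *)
Require Import Defs.
From mathcomp Require Import all_boot all_order all_algebra.
From mathcomp Require Import finmap zify ring lra.

Set Implicit Arguments.
Unset Strict Implicit.
Unset Printing Implicit Defensive.

Import Order.TTheory GRing.Theory Num.Theory.
Local Open Scope ring_scope.

(** Relative to a reference sign [e], the sign sequence of the interior edges
of a snake graph encodes a rational number greater than 1: reading the sequence
from the left, a sign [e] maps the value [w] of the rest to [1 + w], and a sign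
[~~ e] maps the value [w] of the rest (relative to [~~ e]) to [1 + 1/w], the
empty sequence having value 2. This encoding is injective, and changing the
reference sign maps [p/q] to [p/(p-q)]. The sign sequences of a positive or an
even continued fraction have that continued fraction as their value, so all
snake graphs in the theorem have the same signs up to a global change. Signs
determine the directions of the gluings up to exchanging north and east, whence
the isomorphisms. Finally the same recursion counts matchings: removing the
first tile shows that the numerator is the number of perfect matchings, and the
denominator the number of those containing the south or the west edge of the
first tile, whichever has sign [e]. *)

(** * Exact covers by edges *)

Section ExactCovers.
Local Open Scope fset_scope.
Variable K : choiceType.
Implicit Types (E M : {fset {fset K}}) (V e : {fset K}) (v x y : K).

(** Deleting vertices only shrinks [V]; [E] stays fixed, and its edges that leave [V] are simply
    ignored. *)
Definition exact_covers E V : {fset {fset {fset K}}} :=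
  [fset M in fpowerset E | [forall e : M, val e `<=` V] &&
    [forall v : V, #|` [fset e in M | val v \in e]| == 1%N]].

(** The cardinality 1 is split into existence and uniqueness. Uniqueness extends to every [v], since
    no edge of [M] leaves [V]. *)
Lemma exact_coversP E V M :
  reflect [/\ M `<=` E, {in M, forall e, e `<=` V},
              {in V, forall v, exists2 e, e \in M & v \in e}
            & forall v, {in M &, forall e e', v \in e -> v \in e' -> e = e'}]
    (M \in exact_covers E V).
Proof.
rewrite !inE /= fpowersetE.
apply: (iffP and3P) => [[ME /forallP MV /forallP MC]|[ME MV MC MD]].
  have MV' : {in M, forall e, e `<=` V} by move=> e eM; have := MV [` eM].
  split=> // [v vV|v e e' eM e'M ve ve'].
    have /cardfs1P [e eq_e] := MC [` vV].
    by have := fset11 e; rewrite -eq_e !inE /= => /andP [eM ve]; exists e.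
  have vV : v \in V by apply: (fsubsetP (MV' e eM)).
  have /cardfs1P [e0 eq_e] := MC [` vV].
  have : e \in [fset e0] by rewrite -eq_e !inE eM.
  have : e' \in [fset e0] by rewrite -eq_e !inE e'M.
  by rewrite !inE => /eqP -> /eqP ->.
split=> //; apply/forallP => [[z zM]] /=; first exact: MV.
have [e eM ze] := MC z zM; apply/cardfs1P; exists e.
apply/fsetP => e'; rewrite !inE /=; apply/andP/eqP => [[e'M ze']|-> //].
exact: (MD z).
Qed.

Lemma in_fset_sep (T : choiceType) (A : {fset T}) (P : pred T) z :
  (z \in [fset t in A | P t]) = (z \in A) && P z.
Proof. by rewrite in_fset inE. Qed.

Lemma eq_exact_covers E E' V :
  (forall e, e `<=` V -> (e \in E) = (e \in E')) ->
  exact_covers E V = exact_covers E' V.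
Proof.
move=> EE'; apply/fsetP => M.
apply/exact_coversP/exact_coversP => -[ME MV MC MD]; split=> //.
  by apply/fsubsetP => e eM; rewrite -EE' ?MV // (fsubsetP ME).
by apply/fsubsetP => e eM; rewrite EE' ?MV // (fsubsetP ME).
Qed.

(** Adding and removing [e] are inverse bijections between the two families of covers. *)
Lemma card_exact_covers_with E V e : e \in E -> e `<=` V -> e != fset0 ->
  #|` [fset M in exact_covers E V | e \in M]| = #|` exact_covers E (V `\` e)|.
Proof.
move=> eE eV /fset0Pn [z ze].
(* A point [z] of [e] lies outside [V] minus [e], so no cover of the smaller set contains [e], and
   adding [e] is injective. *)
have notin M : M \in exact_covers E (V `\` e) -> e \notin M.
  case/exact_coversP => _ MV _ _; apply/negP => /MV /fsubsetP /(_ z ze).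
  by rewrite !inE ze.
suff -> : [fset M in exact_covers E V | e \in M] =
          [fset e |` M | M in exact_covers E (V `\` e)].
  apply: card_in_imfset => M M' /= /notin eM /notin eM' eq_M.
  by rewrite -(fsetU1K eM) -(fsetU1K eM') eq_M.
apply/fsetP => M; rewrite in_fset_sep; apply/andP/imfsetP => /=.
  case=> /exact_coversP [ME MV MC MD] eM; exists (M `\ e); last first.
    by rewrite fsetD1K.
  apply/exact_coversP; split.
  - by apply: fsubset_trans ME; apply: fsubD1set.
  - move=> e'; rewrite !inE => /andP [e'e e'M]; apply/fsubsetP => v ve'.
    rewrite !inE (fsubsetP (MV _ e'M)) // andbT; apply: contraNN e'e => ve.
    by apply/eqP; apply: (MD v).
  - move=> v; rewrite !inE => /andP [nve /MC [e' e'M ve']]; exists e' => //.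
    by rewrite !inE e'M andbT; apply: contraNneq nve => <-.
  - by move=> v e1 e2; rewrite !inE => /andP [_ ?] /andP [_ ?]; apply: MD.
case=> M' /exact_coversP [ME MV MC MD] ->; split; last by rewrite !inE eqxx.
have MVe e' v : e' \in M' -> v \in e' -> (v \notin e) && (v \in V).
  by move=> /MV /fsubsetP sub /sub; rewrite !inE.
apply/exact_coversP; split.
- by rewrite fsubUset fsub1set eE.
- move=> e'; rewrite !inE => /orP [/eqP -> //|/MVe e'M].
  by apply/fsubsetP => v /e'M /andP [].
- move=> v vV; have [ve|nve] := boolP (v \in e).
    by exists e; rewrite ?inE ?eqxx.
  have [|e' e'M ve'] := MC v; first by rewrite !inE nve.
  by exists e'; rewrite ?inE ?e'M ?orbT.
move=> v e1 e2; rewrite !inE => /orP [/eqP ->|e1M] /orP [/eqP ->|e2M] //.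
- by move=> ve /(MVe _ _ e2M) /andP [/negP].
- by move=> /(MVe _ _ e1M) /andP [/negP].
exact: (MD v).
Qed.

(** Only [e] can cover [v], so every cover contains [e]. *)
Lemma card_exact_covers_pendant E V v e :
  v \in V -> e \in E -> e `<=` V -> v \in e ->
  (forall e', e' \in E -> e' `<=` V -> v \in e' -> e' = e) ->
  #|` exact_covers E V| = #|` exact_covers E (V `\` e)|.
Proof.
move=> vV eE eV ve uniq_e; rewrite -card_exact_covers_with //; last first.
  by apply/fset0Pn; exists v.
congr #|` _|; apply/fsetP => M; rewrite in_fset_sep.
apply/idP/andP => [MC|[] //]; split=> //.
case/exact_coversP: MC => ME MV MC _; have [e' e'M ve'] := MC v vV.
by rewrite -(uniq_e e') ?MV // (fsubsetP ME).
Qed.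

Lemma card_exact_covers_fork E V v e1 e2 :
  v \in V -> e1 != e2 -> e1 \in E -> e2 \in E -> e1 `<=` V -> e2 `<=` V ->
  v \in e1 -> v \in e2 ->
  (forall e, e \in E -> v \in e -> e = e1 \/ e = e2) ->
  #|` exact_covers E V| =
  (#|` exact_covers E (V `\` e1)| + #|` exact_covers E (V `\` e2)|)%N.
Proof.
move=> vV ne12 e1E e2E e1V e2V ve1 ve2 e12.
have n0 e : v \in e -> e != fset0 by move=> ve; apply/fset0Pn; exists v.
rewrite -(card_exact_covers_with e1E e1V (n0 _ ve1)).
rewrite -(card_exact_covers_with e2E e2V (n0 _ ve2)).
rewrite -(cardfsID [fset M in exact_covers E V | e1 \in M]).
congr (_ + _)%N; congr #|` _|; apply/fsetP => M.
  by rewrite in_fsetI in_fset_sep andbA andbb.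
rewrite in_fsetD in_fset_sep [in RHS]in_fset_sep;
  case MC: (M \in exact_covers E V); rewrite ?andbF //= andbT.
case/exact_coversP: MC => ME MV MC MD; apply/idP/idP => [ne1|e2M].
  have [e eM ve] := MC v vV.
  have [ee|<- //] := e12 e (fsubsetP ME _ eM) ve.
  by rewrite -ee eM in ne1.
by apply: contraNN ne12 => e1M; apply/eqP; apply: (MD v).
Qed.

(** If [fset0] were an edge, the family consisting of it would be a second cover of the empty
    set. *)
Lemma card_exact_covers0 E : fset0 \notin E -> #|` exact_covers E fset0| = 1%N.
Proof.
move=> E0; apply/eqP/cardfs1P; exists fset0; apply/fsetP => M; rewrite in_fset1.
apply/exact_coversP/eqP => [[ME MV _ _]|->]; last first.
  by split=> //; rewrite ?fsub0set.
apply/fsetP => e; rewrite in_fset0; apply/negbTE/negP => eM.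
have := MV e eM; rewrite fsubset0 => /eqP e0.
by move/negP: E0; apply; rewrite -e0 (fsubsetP ME).
Qed.

(** * Gluing a square to a graph along one side *)

Section AddTile.
Variables (x y x' y' : K) (E : {fset {fset K}}) (V : {fset K}).
Hypotheses (xV : x \notin V) (yV : y \notin V) (xy : x != y).
Hypotheses (x'V : x' \in V) (y'V : y' \in V) (xy' : x' != y').
Hypothesis EV : {in E, forall e, e `<=` V}.

(** The square has the vertices [x], [y], [y'], [x'] in cyclic order. It is glued along the side
    from [x'] to [y'], so only its other three sides are added. *)
Let E1 := [fset x; y] |` ([fset x; x'] |` ([fset y; y'] |` E)).
Let V1 := x |` (y |` V).

Let xE e : e \in E -> (x \in e) = false.
Proof. by move=> /EV /fsubsetP eV; apply: contraNF xV => /eV. Qed.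
Let yE e : e \in E -> (y \in e) = false.
Proof. by move=> /EV /fsubsetP eV; apply: contraNF yV => /eV. Qed.
Let xx' : x == x' = false.
Proof. by apply: contraNF xV => /eqP ->. Qed.
Let yy' : y == y' = false.
Proof. by apply: contraNF yV => /eqP ->. Qed.
Let xy'' : x == y' = false.
Proof. by apply: contraNF xV => /eqP ->. Qed.
Let yx' : y == x' = false.
Proof. by apply: contraNF yV => /eqP ->. Qed.

Lemma card_exact_covers_tile_new :
  #|` exact_covers E1 (V1 `\` [fset x; y])| = #|` exact_covers E V|.
Proof.
have -> : V1 `\` [fset x; y] = V.
  apply/fsetP => v; rewrite !inE.
  have [->|_] := eqVneq v x; first by rewrite (negbTE xV).
  by have [->|_] := eqVneq v y; first by rewrite (negbTE yV).
congr #|` _|; apply: eq_exact_covers => e /fsubsetP eV; rewrite !inE.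
have [e1|_] := eqVneq e [fset x; y].
  by move: xV; rewrite eV // e1 !inE eqxx.
have [e1|_] := eqVneq e [fset x; x'].
  by move: xV; rewrite eV // e1 !inE eqxx.
have [e1|_] //= := eqVneq e [fset y; y'].
by move: yV; rewrite eV // e1 !inE eqxx.
Qed.

(** Once [x] is matched with [x'], the only edge left at [y] leads to [y'], so the two sides meeting
    the gluing edge are used together. *)
Lemma card_exact_covers_tile_old :
  #|` exact_covers E1 (V1 `\` [fset x; x'])| =
  #|` exact_covers E (V `\` [fset x'; y'])|.
Proof.
rewrite (@card_exact_covers_pendant _ _ y [fset y; y']); first last.
- move=> e; rewrite !inE => /or4P [] /eqP.
  + by move=> -> /fsubsetP /(_ x); rewrite !inE eqxx => /(_ isT).
  + by move=> -> /fsubsetP /(_ x); rewrite !inE eqxx => /(_ isT).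
  + by [].
  by move=> /eqP /yE ->.
- by rewrite !inE eqxx.
- apply/fsubsetP => v; rewrite !inE => /orP [] /eqP ->.
    by rewrite eq_sym (negbTE xy) yx' eqxx orbT.
  by rewrite ![y' == _]eq_sym xy'' (negbTE xy') y'V !orbT.
- by rewrite !inE eqxx !orbT.
- by rewrite !inE eqxx [y == x]eq_sym (negbTE xy) yx' orbT.
have -> : V1 `\` [fset x; x'] `\` [fset y; y'] = V `\` [fset x'; y'].
  apply/fsetP => v; rewrite !inE.
  have [->|vx] := eqVneq v x; first by rewrite (negbTE xV) !andbF.
  have [->|vy] := eqVneq v y; first by rewrite (negbTE yV) !andbF.
  by case: (v == x'); case: (v == y').
congr #|` _|; apply: eq_exact_covers => e /fsubsetP eV; rewrite !inE.
have [e1|_] := eqVneq e [fset x; y].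
  by have := eV x; rewrite e1 !inE eqxx (negbTE xV) !andbF => /(_ isT).
have [e1|_] := eqVneq e [fset x; x'].
  by have := eV x; rewrite e1 !inE eqxx (negbTE xV) !andbF => /(_ isT).
have [e1|_] //= := eqVneq e [fset y; y'].
by have := eV y; rewrite e1 !inE eqxx (negbTE yV) !andbF => /(_ isT).
Qed.

Lemma card_exact_covers_tile :
  #|` exact_covers E1 V1| =
  (#|` exact_covers E V| + #|` exact_covers E (V `\` [fset x'; y'])|)%N.
Proof.
rewrite -card_exact_covers_tile_new -card_exact_covers_tile_old.
apply: (@card_exact_covers_fork _ _ x); rewrite ?inE ?eqxx ?orbT //.
- apply/eqP => /fsetP /(_ y); rewrite !inE eqxx orbT yx' eq_sym.
  by rewrite (negbTE xy).
- by apply/fsubsetP => v; rewrite !inE => /orP [] ->; rewrite ?orbT.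
- apply/fsubsetP => v; rewrite !inE => /orP [->|/eqP ->] //.
  by rewrite x'V !orbT.
move=> e; rewrite !inE => /or4P [/eqP ->|/eqP ->|/eqP ->|/xE ->] //; auto.
by rewrite !inE xy'' (negbTE xy).
Qed.

End AddTile.
End ExactCovers.

(** By [edges_wf] all edges lie inside the vertex set, so the containment condition of a cover is
    automatic. *)
Lemma num_perfect_matchingsE (K : choiceType) (G : graph K) :
  num_perfect_matchings G = #|` exact_covers (edges G) (vertices G)|.
Proof.
congr #|` _|; apply/fsetP => M; rewrite !inE /= /perfect_matching.
rewrite fpowersetE; case ME: (M `<=` edges G)%fset => //=.
suff -> : [forall e : M, (val e `<=` vertices G)%fset] by [].
apply/forallP => -[e eM] /=.
by have [] := edges_wf (fsubsetP ME e eM).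
Qed.

(** * The value of a sign sequence *)

(* The numerator and the denominator, in lowest terms, of the value of [s]
   relative to the sign [e]. *)
Fixpoint sign_frac (e : bool) (s : seq bool) : nat * nat :=
  if s is x :: s' then
    let c := sign_frac x s' in
    if x == e then ((c.1 + c.2)%N, c.2) else ((c.1 + c.2)%N, c.1)
  else (2, 1)%N.

Definition sign_value e s : rat := (sign_frac e s).1%:R / (sign_frac e s).2%:R.

Lemma sign_frac_bounds e s : (0 < (sign_frac e s).2 < (sign_frac e s).1)%N.
Proof.
by elim: s e => //= x s IHs e; have := IHs x; case: (x == e) => /=; lia.
Qed.

Lemma coprime_sign_frac e s : coprime (sign_frac e s).1 (sign_frac e s).2.
Proof.
elim: s e => //= x s IHs e; rewrite /coprime.
case: (x == e); rewrite /= gcdnC ?gcdnDr ?gcdnDl; last exact: IHs.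
by rewrite gcdnC; exact: IHs.
Qed.

(** For either reference sign the numerator is the same, and the two possible denominators add up to
    it. *)
Lemma sign_frac_negb e s : sign_frac (~~ e) s =
  ((sign_frac e s).1, ((sign_frac e s).1 - (sign_frac e s).2)%N).
Proof.
case: s => //= x s; have := sign_frac_bounds x s.
by case: x e => -[] /=; move=> ?; congr pair; lia.
Qed.

(** Only equalities between signs enter the recursion, so flipping all of them together with the
    reference changes nothing. *)
Lemma sign_frac_map_addb b e s :
  sign_frac (b (+) e) (map (addb b) s) = sign_frac e s.
Proof.
by elim: s e => //= x s IHs e; rewrite IHs (inj_eq (can_inj (addKb b))).
Qed.

(** The value is 2 for the empty sequence, above 2 if the first sign is [e], and below 2 otherwise.
    Hence the value determines the first sign, and then the value of the rest. *)
Lemma sign_frac_inj e : injective (sign_frac e).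
Proof.
move=> s; elim: s e => [|x s IHs] e [|y t] //=.
- by have := sign_frac_bounds y t; case: (y == e) => /= ? [] *; lia.
- by have := sign_frac_bounds x s; case: (x == e) => /= ? [] *; lia.
have := sign_frac_bounds x s; have := sign_frac_bounds y t.
have [->|ye] := eqVneq y e; have [->|xe] := eqVneq x e => /= ? ? [] ? ?;
  try lia.
  by rewrite (IHs e t) //; apply: injective_projections; lia.
have exy : x = y by case: (x) (y) e xe ye => -[] [].
subst y; rewrite (IHs x t) //.
by apply: injective_projections; lia.
Qed.

Lemma sign_value_gt1 e s : 1 < sign_value e s.
Proof.
have /andP [Q0 QP] := sign_frac_bounds e s.
by rewrite /sign_value ltr_pdivlMr ?ltr0n // mul1r ltr_nat.
Qed.

Lemma sign_value_nil e : sign_value e [::] = 2.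
Proof. by []. Qed.

Lemma sign_value_same e s : sign_value e (e :: s) = 1 + sign_value e s.
Proof.
have /andP [Q0 _] := sign_frac_bounds e s.
by rewrite /sign_value /= eqxx natrD mulrDl divff ?pnatr_eq0 -?lt0n // addrC.
Qed.

Lemma sign_value_negb_cons e s :
  sign_value e (~~ e :: s) = 1 + (sign_value (~~ e) s)^-1.
Proof.
have /andP [Q0 QP] := sign_frac_bounds (~~ e) s.
have -> : sign_value e (~~ e :: s) =
    ((sign_frac (~~ e) s).1 + (sign_frac (~~ e) s).2)%:R
      / (sign_frac (~~ e) s).1%:R.
  by rewrite /sign_value /=; case: e {Q0 QP}.
rewrite natrD mulrDl divff ?pnatr_eq0 -?lt0n ?(ltn_trans Q0) //.
by rewrite /sign_value invf_div.
Qed.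

Lemma sign_value_nseq e k s :
  sign_value e (nseq k e ++ s) = k%:R + sign_value e s.
Proof.
by elim: k => [|k IHk] /=; rewrite ?add0r // sign_value_same IHk addrA nat1r.
Qed.

Lemma sign_value_negb e s : (sign_value (~~ e) s)^-1 = 1 - (sign_value e s)^-1.
Proof.
have /andP [Q0 QP] := sign_frac_bounds e s.
rewrite /sign_value sign_frac_negb !invf_div natrB ?(ltnW QP) //.
rewrite mulrBl divff //.
by rewrite pnatr_eq0; lia.
Qed.

(** Both fractions are in lowest terms, so Gauss's lemma makes the numerators divide each other. *)
Lemma sign_frac_of_value e s p q : coprime p q -> (0 < q)%N ->
  sign_value e s = p%:R / q%:R -> sign_frac e s = (p, q).
Proof.
have := coprime_sign_frac e s; have /andP [] := sign_frac_bounds e s.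
rewrite /sign_value; case: (sign_frac e s) => P Q /= Q0 QP cPQ cpq q0 /eqP.
rewrite eqr_div ?pnatr_eq0 -?lt0n // -!natrM eqr_nat => /eqP eq_Pq.
have PE : P = p.
  apply/eqP; rewrite eqn_dvd -(Gauss_dvdl _ cPQ) -eq_Pq dvdn_mulr //=.
  by rewrite -(Gauss_dvdl _ cpq) eq_Pq dvdn_mulr.
move: eq_Pq; rewrite PE => /eqP.
by rewrite eqn_pmul2l ?(leq_trans _ QP) -?PE ?(ltn_trans Q0) // => /eqP ->.
Qed.

Lemma sign_value_inj e e' s s' : sign_value e s = sign_value e' s' ->
  s = map (addb (e (+) e')) s'.
Proof.
move=> eq_ss; have /andP [Q0 _] := sign_frac_bounds e' s'.
have /(_ (e (+) e')) E := sign_frac_map_addb _ e' s'.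
(* The reference [e] is written as [e (+) e' (+) e'], the flip by [e (+) e'] of the reference
   [e']. *)
apply: (@sign_frac_inj e); rewrite -{2}[e](addbK e') E.
rewrite (sign_frac_of_value (coprime_sign_frac e' s') Q0 eq_ss).
by case: (sign_frac e' s').
Qed.

(** * Continued fractions as values of sign sequences *)

Lemma cfrac_cons2 x y c : cfrac [:: x, y & c] = x%:~R + (cfrac (y :: c))^-1.
Proof. by []. Qed.

(** With its first sign dropped, a block of [x] signs contributes [x - 1]; the missing 1 comes from
    the sign change that starts the next block, which maps [w] to 1 + 1/[w]. The last block is
    shorter by one more sign because the empty sequence has value 2. *)
Lemma alternating_value e x (a : seq nat) :
  (0 < x)%N -> all (fun n => 0 < n)%N a -> (1 < x + sumn a)%N ->
  exists2 s, alternating e (x :: a) = e :: s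
           & sign_value e s = cfrac [seq n%:Z | n <- x :: a].
Proof.
elim: a e x => [|y a IHa] e x x0 a0 xa1.
  case: x x0 xa1 => [|[|x]] // _ _; exists (nseq x e) => //=.
  rewrite -[nseq _ _]cats0 sign_value_nseq sign_value_nil.
  by rewrite -natrD addn2 pmulrn.
case: x x0 {xa1} => // x _; case/andP: a0 => y0 a0.
exists (nseq x e ++ alternating (~~ e) (y :: a)) => //.
rewrite map_cons cfrac_cons2 sign_value_nseq -pmulrn -natr1 -addrA.
congr (_ + _); have [ya1|ya1] := ltnP 1 (y + sumn a).
  have [s -> vs] := IHa (~~ e) y y0 a0 ya1.
  by rewrite sign_value_negb_cons vs.
(* A tail [[:: 1]] produces no sign at all; the value 2 of the empty sequence then equals 1 +
   1/1. *)
have a_nil : a = [::] by case: a a0 ya1 {IHa} => //= z a /andP []; lia.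
have -> : y = 1%N by lia.
by rewrite a_nil /= sign_value_nil invr1.
Qed.

(** If [w] is the absolute value of the tail, the join gives [|x| + 1/w] for equal signs of [x] and
    [y] and [|x| - 1/w] for opposite ones. Since [w > 1] and [|x| >= 2], the term [x] dominates,
    which fixes the sign of the fraction and allows taking absolute values. *)
Lemma even_join_value f i x b ts :
  even_cf (x :: b) -> even_join f i (x :: b) ts ->
  [/\ ts != [::],
      sign_value (even_sign i x) (map f (interior_edges ts)) =
        `|cfrac (x :: b)|
    & Num.sg (cfrac (x :: b)) = Num.sg x%:~R].
Proof.
elim: b i x ts => [|y b IHb] i x ts /and3P [_ /andP [x0 x2] b2].
  move=> /= [szts ->]; split=> //; first by case: ts szts => //=; lia.
  rewrite -[nseq _ _]cats0 sign_value_nseq sign_value_nil -natrD.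
  by rewrite -intr_norm -abszE pmulrn; congr (_%:~R); lia.
case=> ts1 [ts2 [[sz1 f1] /IHb [//|ts2n v2 sg2] J]].
have y0 : y != 0 by case/andP: b2 => /andP [].
have v1 := sign_value_gt1 (even_sign i.+1 y) (map f (interior_edges ts2)).
(* The factor (-1)^(i+1) makes consecutive zigzags differ in sign exactly when [x] and [y] have the
   same sign. *)
have esy : even_sign i.+1 y = (even_sign i x) (+) ((0 < x) == (0 < y)).
  by rewrite /even_sign /=; case: (odd i); rewrite /=; lia.
have [k xk] : exists k, `|x|%N = k.+2 by exists (`|x| - 2)%N; lia.
case: ts1 sz1 f1 J => [|t1 ts1] sz1 f1 J; first by move: sz1; rewrite xk.
case: ts2 ts2n v2 v1 J => // t2 ts2 _ v2 v1 J; rewrite cfrac_cons2.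
have kx : k.+2%:R = `|x%:~R| :> rat by rewrite -xk -intr_norm -abszE pmulrn.
(* The first zigzag gives [|x| - 2] signs. A connecting tile adds a sign of each kind, hence 2 +
   1/[w]; an identified edge adds one opposite sign, hence 1 + (1 - 1/[w]), the reference sign being
   changed back by [sign_value_negb]. *)
have {J} [ts0 ->] : ts != [::] /\
    sign_value (even_sign i x) (map f (interior_edges ts)) =
      if (0 < x) == (0 < y) then k.+2%:R + `|cfrac (y :: b)|^-1
      else k.+2%:R - `|cfrac (y :: b)|^-1.
  rewrite -v2; case: ifP J esy f1 => _ /=.
    case=> t [-> fe1 fe2] esy f1; split=> //=.
    rewrite pairmap_cat map_cat /= f1 fe1 fe2 xk subn2 /=.
    rewrite sign_value_nseq esy addbT.
    by rewrite sign_value_same sign_value_negb_cons -2!addn1 !natrD; ring.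
  case=> -> fe1 esy f1; split=> //=.
  rewrite pairmap_cat map_cat /= f1 fe1 xk subn2 /= sign_value_nseq esy addbF.
  by rewrite sign_value_negb_cons sign_value_negb -2!addn1 !natrD; ring.
have B1 : 0 < `|cfrac (y :: b)|^-1 < 1.
  by rewrite invr_gt0 invf_lt1 -v2 ?(lt_trans ltr01 v1).
have k2 : 2 <= k.+2%:R :> rat by rewrite ler_nat.
have X : x%:~R = (if 0 < x then k.+2%:R else - k.+2%:R) :> rat.
  rewrite kx; have [xgt0|] := ltrP 0 x; first by rewrite gtr0_norm ?ltr0z.
  by move=> xle0; rewrite ler0_norm ?opprK ?lerz0.
have Y : (cfrac (y :: b))^-1 =
    if 0 < y then `|cfrac (y :: b)|^-1 else - `|cfrac (y :: b)|^-1.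
  move: sg2; have [ygt0|yle0] := ltrP 0 y.
    rewrite (gtr0_sg (x := y%:~R)) ?ltr0z // => /eqP; rewrite sgr_cp0 => C0.
    by rewrite gtr0_norm.
  rewrite (ltr0_sg (x := y%:~R)) ?ltrz0 ?lt_neqAle ?y0 // => /eqP.
  by rewrite sgr_cp0 => C0; rewrite -invrN ltr0_norm ?opprK.
rewrite {}X {}Y; move: (`|_|^-1) B1 => B /andP [B0 B1].
case: (0 < x); case: (0 < y) => /=; split=> //.
- by rewrite gtr0_norm //; lra.
- by rewrite !gtr0_sg //; lra.
- by rewrite gtr0_norm //; lra.
- by rewrite !gtr0_sg //; lra.
- by rewrite ltr0_norm; lra.
- by rewrite !ltr0_sg //; lra.
- by rewrite ltr0_norm; lra.
- by rewrite !ltr0_sg //; lra.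
Qed.

(** The sign function and the reference sign are left free, which absorbs global sign changes. The
    condition [ts != [::]] tells a single tile from a single edge: neither has interior edges. *)
Definition realizes (ts : seq tile) (v : rat) : Prop :=
  [/\ snake ts, ts != [::]
    & exists (f : edge -> bool) (e : bool),
        sign_function ts f /\ sign_value e (map f (interior_edges ts)) = v].

Lemma positive_signs_alternating eps x a : (1 < x)%N ->
  alternating (~~ eps) (x :: a) = ~~ eps :: positive_signs eps (x :: a).
Proof.
case: x => [|[|x]] // _; case: a => [|y a] /=; first by rewrite subn2.
by rewrite negbK.
Qed.

Lemma positive_snake_realizes x a ts :
  positive_cf (x :: a) -> (1 < x)%N -> positive_snake (x :: a) ts ->
  realizes ts (cfrac [seq n%:Z | n <- x :: a]).
Proof.
move=> /and3P [_ x0 a0] x1 [sts sz [f [eps [sf fE]]]]; split=> //.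
  by case: ts sz {sts sf fE} => //=; lia.
exists f, (~~ eps); split=> //; rewrite fE.
have [|s] := alternating_value (~~ eps) x0 a0; first by lia.
by rewrite positive_signs_alternating // => -[<-].
Qed.

(** The leading 1 contributes an empty block, so the signs are those of [x :: a] with [eps]
    flipped. *)
Lemma positive_snake1_realizes x a ts :
  positive_cf (x :: a) -> (1 < x)%N ->
  positive_snake [:: 1%N, (x - 1)%N & a] ts ->
  realizes ts (cfrac [seq n%:Z | n <- x :: a]).
Proof.
move=> xa x1 [sts sz [f [eps [sf fE]]]].
apply: positive_snake_realizes => //; split=> //.
  by rewrite sz /=; lia.
exists f, (~~ eps); split=> //; rewrite fE.
case: x x1 {xa sz fE} => [|[|x]] // _; case: a => [|y a] /=.
  by rewrite negbK !subn1 !subn2.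
by rewrite negbK !subn1.
Qed.

Lemma even_snake_realizes b ts p q : (0 < p)%N -> (q < p)%N ->
  even_cf b -> cfrac b = p%:R / q%:R \/ cfrac b = p%:R / (p%:R - q%:R) ->
  even_snake b ts -> realizes ts (p%:R / q%:R).
Proof.
move=> p0 qp; case: b => // x b eb cfb [sts [f [sf jb]]].
have [ts0 vb _] := even_join_value eb jb; split=> //.
have pq0 : 0 < p%:R - q%:R :> rat by rewrite subr_gt0 ltr_nat.
case: cfb vb => ->.
  by rewrite ger0_norm ?divr_ge0 // => vb; exists f, (even_sign 1 x).
rewrite gtr0_norm ?divr_gt0 ?ltr0n // => vb.
(* Flipping the reference sign turns the value p/(p-q) into p/q. *)
exists f, (~~ even_sign 1 x); split=> //; apply: invr_inj.
rewrite sign_value_negb vb !invf_div mulrBl divff ?pnatr_eq0 ?gt_eqF //.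
by rewrite opprB addrCA subrr addr0.
Qed.

(** * Signs determine the snake graph *)

Lemma imfset_fset2 (K L : choiceType) (f : K -> L) x y :
  (f @` [fset x; y] = [fset f x; f y])%fset.
Proof.
apply/fsetP => z; rewrite !inE; apply/imfsetP/orP => /= [[w + ->]|].
  by rewrite !inE => /orP [] /eqP ->; rewrite eqxx; auto.
by case=> /eqP ->; [exists x|exists y]; rewrite ?inE ?eqxx ?orbT.
Qed.

Lemma isomorphic_imfset (K L : choiceType) (G : graph K) (H : graph L)
    (f : K -> L) (g : L -> K) :
  cancel f g -> cancel g f ->
  edges H = [fset f @` (e : {fset K}) | e in edges G]%fset ->
  vertices H = (f @` vertices G)%fset ->
  isomorphic G H.
Proof.
move=> fK gK EH VH; have f_inj := can_inj fK.
have fV (x : vertices G) : f (val x) \in vertices H.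
  by rewrite VH in_imfset //=; apply: valP.
have gV (y : vertices H) : g (val y) \in vertices G.
  move: (val y) (valP y) => z; rewrite VH => /imfsetP [x /= xG ->].
  by rewrite fK.
exists (fun x => [` fV x]%fset); split.
  by exists (fun y => [` gV y]%fset) => x; apply: val_inj; rewrite /= ?fK ?gK.
move=> x y; rewrite /adjacent /= EH.
rewrite -imfset_fset2; apply/imfsetP/idP => /= [[e eG E]|xyG]; last first.
  by exists [fset val x; val y]%fset.
suff -> : [fset val x; val y]%fset = e by [].
by apply/fsetP => z; rewrite -!(mem_imfset imfset_key _ f_inj) /= E.
Qed.

(** * Reflections and translations of the grid *)

Definition swap_if (b : bool) (v : point) : point :=
  if b then (v.2, v.1) else v.

Lemma swap_ifK b : involutive (swap_if b).
Proof. by case: b => -[]. Qed.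

Lemma swap_ifD b u v : swap_if b (u + v) = swap_if b u + swap_if b v.
Proof. by case: b. Qed.

Definition move_point (b : bool) (c v : point) : point := swap_if b v + c.

Lemma move_pointD b c u v :
  move_point b c (u + v) = move_point b c u + swap_if b v.
Proof. by rewrite /move_point swap_ifD addrAC. Qed.

(** Equality holds up to order only: the reflection exchanges south with west and north with
    east. *)
Lemma move_tile_edges b c t :
  map (fun e : edge => move_point b c @` e)%fset (tile_edges t) =i
  tile_edges (move_point b c t).
Proof.
move=> e; rewrite /= /north /east /south /west !imfset_fset2 !move_pointD.
case: b; last by [].
rewrite -[swap_if true east_step]/north_step.
rewrite -[swap_if true north_step]/east_step !inE.
by do 4!case: (e == _).
Qed.

Lemma snake_edgesP ts e : ts != [::] ->
  reflect (exists2 t, t \in ts & e \in tile_edges t) (e \in snake_edges ts).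
Proof. by case: ts => // t ts _; rewrite in_fset; apply: flatten_mapP. Qed.

Lemma move_snake_edges b c ts : ts != [::] ->
  snake_edges (map (move_point b c) ts) =
  [fset move_point b c @` (e : edge) | e in snake_edges ts]%fset.
Proof.
move=> ts0; have mts0 : map (move_point b c) ts != [::] by case: ts ts0.
apply/fsetP => e; apply/(snake_edgesP _ mts0)/imfsetP => /=.
  case=> _ /mapP [t tts ->]; rewrite -move_tile_edges => /mapP [e' e't ->].
  by exists e' => //; apply/(snake_edgesP _ ts0); exists t.
case=> e' /(snake_edgesP _ ts0) [t tts e't] ->.
exists (move_point b c t); rewrite ?map_f // -move_tile_edges.
exact: (map_f (fun e : edge => move_point b c @` e)%fset).
Qed.

Lemma snake_verticesP ts v :
  reflect (exists2 e, e \in snake_edges ts & v \in e) (v \in snake_vertices ts).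
Proof.
apply: (iffP (bigfcupP _ _ _ _)) => [[e + ve]|[e es ve]].
  by rewrite andbT => es; exists e.
by exists e; rewrite ?es.
Qed.

Lemma move_snake_isomorphic b c ts : ts != [::] ->
  isomorphic (snake_graph ts) (snake_graph (map (move_point b c) ts)).
Proof.
move=> ts0; apply: (@isomorphic_imfset _ _ _ _ (move_point b c)
   (fun v => swap_if b (v - c))).
- by move=> v; rewrite /move_point addrK swap_ifK.
- by move=> v; rewrite /move_point swap_ifK subrK.
- exact: move_snake_edges.
apply/fsetP => v; apply/snake_verticesP/imfsetP => /=.
  case=> e; rewrite move_snake_edges // => /imfsetP [e' /= e'ts ->].
  case/imfsetP => w /= we' ->; exists w => //.
  by apply/snake_verticesP; exists e'.
case=> w /snake_verticesP [e ets we] ->; exists (move_point b c @` e)%fset.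
  by rewrite move_snake_edges //; apply/imfsetP; exists e.
by rewrite in_imfset.
Qed.

Lemma next_tileE f t t' : sign_function [:: t] f -> next_tile t t' ->
  t' = if f (shared_edge t t') == f (west t) then t + north_step
       else t + east_step.
Proof.
move=> /(_ t); rewrite mem_seq1 eqxx => /(_ isT) [nw se ns].
rewrite /next_tile /shared_edge => /orP [] /eqP ->; last first.
  by rewrite eqxx nw eqxx.
by rewrite (inj_eq (addrI t)) /= -se -nw ns; case: (f (south t)).
Qed.

(** West signs alternate along the snake whichever way it turns, so with [next_tileE] the interior
    signs and one west sign determine all directions. *)
Lemma sign_next_west f t t' : sign_function [:: t; t'] f -> next_tile t t' ->
  f (west t') = ~~ f (west t).
Proof.
move=> sf; have [] := sf t; rewrite ?inE ?eqxx // => nw se ns.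
have [] := sf t'; rewrite ?inE ?eqxx ?orbT // => nw' se' ns'.
case/orP => /eqP t'E; first by rewrite t'E -[west _]/(east t) -se -nw ns negbK.
by rewrite -nw' ns' t'E -[south _]/(north t) nw.
Qed.

Lemma sub_sign_function ts ts' f :
  {subset ts' <= ts} -> sign_function ts f -> sign_function ts' f.
Proof. by move=> sub sf t /sub; apply: sf. Qed.

Lemma snake_of_signs f g b t ts u us : snake (t :: ts) -> snake (u :: us) ->
  sign_function (t :: ts) f -> sign_function (u :: us) g ->
  map f (interior_edges (t :: ts)) =
    map (addb b) (map g (interior_edges (u :: us))) ->
  exists d c, u :: us = map (move_point d c) (t :: ts).
Proof.
(* [d] tells whether the two snakes take exchanged directions at the first step. *)
pose d := b (+) f (west t) (+) g (west u).
move=> sts sus sf sg fg; exists d, (u - swap_if d t).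
have move_t : move_point d (u - swap_if d t) t = u.
  by rewrite /move_point addrC subrK.
move: (u - _) move_t => c; move: sts sus sf sg fg; rewrite /d {d}.
elim: ts t u us => [|t' ts IHts] t u [|u' us] //= => [_ _ _ _ _ ->|] //.
move=> /andP [tt' st] /andP [uu' su] sf sg [fg1 fg] tu.
have sub2 (x y : tile) s : {subset [:: x; y] <= [:: x, y & s]}.
  by move=> z; rewrite !inE => /orP [] ->; rewrite ?orbT.
have sub1 (x : tile) s : {subset [:: x] <= x :: s}.
  by move=> z; rewrite !inE => ->.
have wt := sign_next_west (sub_sign_function (@sub2 _ _ _) sf) tt'.
have wu := sign_next_west (sub_sign_function (@sub2 _ _ _) sg) uu'.
have t'E := next_tileE (sub_sign_function (@sub1 _ _) sf) tt'.
have u'E := next_tileE (sub_sign_function (@sub1 _ _) sg) uu'.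
(* Both west signs flip at each step, so [d] is the same for the two tails and one motion serves the
   whole snake. *)
have eqd : b (+) f (west t') (+) g (west u') = b (+) f (west t) (+) g (west u).
  by rewrite wt wu !addbN addNb negbK.
rewrite tu; congr cons; rewrite -eqd; apply: IHts => //.
- by move=> z zts; apply: sf; rewrite inE zts orbT.
- by move=> z zus; apply: sg; rewrite inE zus orbT.
rewrite eqd t'E u'E fg1.
case: (g (shared_edge u u')) (b) (f (west t)) (g (west u)) tu => -[] [] [] /=;
  by rewrite move_pointD => ->.
Qed.

Lemma realizes_isomorphic ts us v : realizes ts v -> realizes us v ->
  isomorphic (snake_graph ts) (snake_graph us).
Proof.
move=> [sts ts0 [f [e [sf <-]]]].
move=> [sus us0 [g [e' [sg /esym /sign_value_inj fg]]]].
case: ts us ts0 us0 sts sus sf sg fg => // t ts [|u us] // _ _ sts sus sf sg fg.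
have [d [c ->]] := snake_of_signs sts sus sf sg fg.
exact: move_snake_isomorphic.
Qed.

(** * Counting perfect matchings *)

(* When [e] is an edge of the snake graph, these covers are its perfect
   matchings containing [e], with [e] removed. *)
Definition num_covers (ts : seq tile) (e : edge) : nat :=
  #|` exact_covers (snake_edges ts) (snake_vertices ts `\` e)%fset|.

(* [x] and [y] are the new vertices of the first tile, glued to the rest along
   the edge with endpoints [x'] and [y']. *)
Lemma num_covers_tile (ts : seq tile) (x y x' y' : point) (E : {fset edge})
    (V : {fset point}) :
  x \notin V -> y \notin V -> x != y -> x' \in V -> y' \in V -> x' != y' ->
  {in E, forall e : edge, e `<=` V}%fset ->
  {in V, forall v, exists2 e : edge, e \in E & v \in e} ->
  snake_edges ts =i
    [predU1 [fset x; y]%fset & [predU1 [fset x; x']%fset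
       & [predU1 [fset y; y']%fset & E]]] ->
  [/\ num_covers ts [fset x; y]%fset = #|` exact_covers E V|,
      num_covers ts [fset x; x']%fset =
        #|` exact_covers E (V `\` [fset x'; y'])%fset|
    & num_covers ts fset0 =
        (#|` exact_covers E V| +
         #|` exact_covers E (V `\` [fset x'; y'])%fset|)%N].
Proof.
move=> xV yV xy x'V y'V xy' EV VE tsE.
have eqE : snake_edges ts =
    ([fset x; y] |` ([fset x; x'] |` ([fset y; y'] |` E)))%fset.
  by apply/fsetP => e; rewrite tsE !inE.
have eqV : snake_vertices ts = (x |` (y |` V))%fset.
  apply/fsetP => v; apply/snake_verticesP/idP => [[e + ve]|].
    rewrite tsE !inE => /or4P [/eqP eE|/eqP eE|/eqP eE|/EV /fsubsetP sub].
    - by move: ve; rewrite eE !inE => /orP [] ->; rewrite ?orbT.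
    - by move: ve; rewrite eE !inE => /orP [->|/eqP ->] //; rewrite x'V !orbT.
    - by move: ve; rewrite eE !inE => /orP [->|/eqP ->]; rewrite ?y'V !orbT.
    by rewrite sub ?orbT.
  rewrite !inE => /or3P [vx|vy|/VE [e eE ve]].
  - by exists [fset x; y]%fset; rewrite ?tsE !inE ?eqxx ?vx.
  - by exists [fset x; y]%fset; rewrite ?tsE !inE ?eqxx ?vy ?orbT.
  by exists e; rewrite ?tsE // !inE eE !orbT.
rewrite /num_covers eqE eqV fsetD0; split.
- exact: card_exact_covers_tile_new.
- exact: card_exact_covers_tile_old.
- exact: card_exact_covers_tile.
Qed.

Lemma tile_edges_ge t e v : e \in tile_edges t -> v \in e ->
  (t.1 <= v.1) && (t.2 <= v.2).
Proof.
case: t => a b; rewrite !inE.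
by case/or4P => /eqP ->; rewrite !inE => /orP [] /eqP -> /=; lia.
Qed.

(** As a snake only moves north and east, this keeps the two free vertices of a preceding tile out
    of the rest of the snake. *)
Lemma snake_vertices_ge t ts v : path next_tile t ts ->
  v \in snake_vertices (t :: ts) -> (t.1 <= v.1) && (t.2 <= v.2).
Proof.
move=> pts /snake_verticesP [e /(@snake_edgesP (t :: ts) e isT) [u uts eu] ve].
have /andP [u1 u2] := tile_edges_ge eu ve.
suff /andP [t1 t2] : (t.1 <= u.1) && (t.2 <= u.2).
  by rewrite (le_trans t1 u1) (le_trans t2 u2).
move: uts; rewrite inE => /orP [/eqP -> //|uts]; first by rewrite !lexx.
pose r (u v : point) := (u.1 <= v.1) && (u.2 <= v.2).
have r_trans : transitive r.
  by move=> w u' w' /andP [u1' u2'] /andP [w1 w2]; apply/andP; split;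
    [exact: le_trans w1|exact: le_trans w2].
suff /(order_path_min r_trans) /allP /(_ u uts) : path r t ts by [].
apply: sub_path pts => -[a b] c /orP [] /eqP ->; rewrite /r /=; lia.
Qed.

Lemma mem_snake_edges_cons t ts e : ts != [::] ->
  (e \in snake_edges (t :: ts)) =
  (e \in tile_edges t) || (e \in snake_edges ts).
Proof.
move=> ts0; apply/(@snake_edgesP (t :: ts) e isT)/orP => [[u]|].
  rewrite inE => /orP [/eqP ->|uts eu]; [by left|right].
  by apply/snake_edgesP => //; exists u.
case=> [et|/(snake_edgesP _ ts0) [u uts eu]].
  by exists t; rewrite ?mem_head.
by exists u; rewrite // inE uts orbT.
Qed.

Lemma neq_addl (u v w : point) : v != w -> u + v != u + w.
Proof. by rewrite (inj_eq (addrI u)). Qed.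

(** Of the south and west sides of [t], [e1] is the one opposite the gluing edge and [e2] the one
    meeting it. Using [e1] leaves the rest of the snake intact; using [e2] forces the side facing it
    and uses up both ends of the gluing edge. *)
Lemma num_covers_cons t u ts e1 e2 : path next_tile t (u :: ts) ->
  (u = t + north_step /\ (e1, e2) = (south t, west t)) \/
  (u = t + east_step /\ (e1, e2) = (west t, south t)) ->
  [/\ num_covers [:: t, u & ts] e1 = num_covers (u :: ts) fset0,
      num_covers [:: t, u & ts] e2 =
        num_covers (u :: ts) (shared_edge t u)
    & num_covers [:: t, u & ts] fset0 =
        (num_covers (u :: ts) fset0 +
         num_covers (u :: ts) (shared_edge t u))%N].
Proof.
move=> /= /andP [_ pts] tu; set us := u :: ts.
have ge_u v : v \in snake_vertices us -> (u.1 <= v.1) && (u.2 <= v.2).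
  exact: snake_vertices_ge.
have EV : {in snake_edges us, forall e : edge, e `<=` snake_vertices us}%fset.
  by move=> e /snake_graph_wf [].
have VE : {in snake_vertices us, forall v, exists2 e : edge,
    e \in snake_edges us & v \in e}.
  by move=> v /snake_verticesP.
have eus_of e : e \in tile_edges u -> e \in snake_edges us.
  by move=> eu; apply/(@snake_edgesP us e isT); exists u; rewrite ?mem_head.
have memV e v : e \in tile_edges u -> v \in e -> v \in snake_vertices us.
  by move=> /eus_of eus ve; apply/snake_verticesP; exists e.
rewrite [num_covers us fset0]/num_covers fsetD0.
case: tu => -[uE [-> ->]].
  have -> : shared_edge t u = [fset u; (u + east_step)%R]%fset.
    by rewrite /shared_edge uE eqxx.
  have wE : west t = [fset t; u]%fset by rewrite /west uE.
  have eE : east t = [fset (t + east_step)%R; (u + east_step)%R]%fset.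
    by rewrite /east /west uE addrAC.
  have nE : north t = south u by rewrite uE.
  rewrite wE; apply: num_covers_tile => //.
  - by apply/negP => /ge_u; rewrite uE; case: (t) => a b /=; lia.
  - by apply/negP => /ge_u; rewrite uE; case: (t) => a b /=; lia.
  - by rewrite -[X in X != _]addr0 neq_addl.
  - by apply: (memV (south u)); rewrite !inE eqxx ?orbT.
  - by apply: (memV (south u)); rewrite !inE eqxx ?orbT.
  - by rewrite -[X in X != _]addr0 neq_addl.
  move=> e; rewrite mem_snake_edges_cons // !inE -wE -eE -/(south t) nE.
  have [->|_] := eqVneq e (south u); first by rewrite !orbT.
  by case: (e == south t); case: (e == east t); case: (e == west t).
have -> : shared_edge t u = [fset u; (u + north_step)%R]%fset.
  by rewrite /shared_edge uE (inj_eq (addrI t)).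
have soE : south t = [fset t; u]%fset by rewrite /south uE.
have nE : north t = [fset (t + north_step)%R; (u + north_step)%R]%fset.
  by rewrite /north /south uE addrAC.
have eE : east t = west u by rewrite uE.
rewrite soE; apply: num_covers_tile => //.
- by apply/negP => /ge_u; rewrite uE; case: (t) => a b /=; lia.
- by apply/negP => /ge_u; rewrite uE; case: (t) => a b /=; lia.
- by rewrite -[X in X != _]addr0 neq_addl.
- by apply: (memV (west u)); rewrite !inE eqxx ?orbT.
- by apply: (memV (west u)); rewrite !inE eqxx ?orbT.
- by rewrite -[X in X != _]addr0 neq_addl.
move=> e; rewrite mem_snake_edges_cons // !inE -soE -nE -/(west t) eE.
have [->|_] := eqVneq e (west u); first by rewrite !orbT.
by case: (e == south t); case: (e == north t); case: (e == west t).
Qed.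

(** The tile is viewed as glued to the graph whose only edge is its north edge. *)
Lemma num_covers_single t :
  [/\ num_covers [:: t] (south t) = 1%N, num_covers [:: t] (west t) = 1%N
    & num_covers [:: t] fset0 = 2%N].
Proof.
pose E := [fset north t]%fset; pose V := north t.
have En : north t \in E by rewrite inE.
have c0 : #|` exact_covers E (V `\` north t)%fset| = 1%N.
  rewrite fsetDv; apply: card_exact_covers0; rewrite inE eq_sym.
  by rewrite -cardfs_eq0 south_card.
have c1 : #|` exact_covers E V| = 1%N.
  rewrite -c0; apply: (@card_exact_covers_pendant _ _ _ (t + north_step)) => //.
  - by rewrite !inE eqxx.
  - by rewrite !inE eqxx.
  by move=> e; rewrite inE => /eqP.
rewrite -[2%N]/(1 + 1)%N -{1 3}c1 -c0.
apply: (@num_covers_tile _ _ _ (t + north_step)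
         (t + north_step + east_step)) => //.
- by rewrite !inE; case: t {E V En c0 c1} => a b; rewrite !xpair_eqE /=; lia.
- by rewrite !inE; case: t {E V En c0 c1} => a b; rewrite !xpair_eqE /=; lia.
- by rewrite -[X in X != _]addr0 neq_addl.
- by rewrite !inE eqxx.
- by rewrite !inE eqxx orbT.
- by rewrite -[X in X != _]addr0 neq_addl.
- by move=> e; rewrite inE => /eqP ->.
- by move=> v vV; exists (north t).
have eE : east t =
    [fset (t + east_step)%R; (t + north_step + east_step)%R]%fset.
  by rewrite /east /west addrAC.
move=> e; rewrite -eE -/(south t) -/(west t).
apply/(@snake_edgesP [:: t] e isT)/idP => [[u]|].
  rewrite inE => /eqP ->; rewrite /E !inE.
  by do 4!case: (e == _).
move=> et; exists t; rewrite ?mem_head //; move: et; rewrite /E !inE.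
by do 4!case: (e == _).
Qed.

(** The gluing edge has the sign of the one of the south and west sides of [t] that meets it, and
    the opposite sign of the one facing it. So the two cases of [num_covers_cons] are the two cases
    of the recursion. *)
Lemma num_covers_sign_frac f t ts : path next_tile t ts ->
  sign_function (t :: ts) f ->
  forall e, e \in [:: south t; west t] ->
  let c := sign_frac (f e) (map f (pairmap shared_edge t ts)) in
  num_covers (t :: ts) fset0 = c.1 /\ num_covers (t :: ts) e = c.2.
Proof.
elim: ts t => [|t' ts IHts] t pts sf e ee.
  have [ns nw n0] := num_covers_single t; split; first by rewrite n0.
  by move: ee; rewrite !inE => /orP [] /eqP ->; rewrite ?ns ?nw.
have /andP [tt' pts'] : next_tile t t' && path next_tile t' ts := pts.
have sf' : sign_function (t' :: ts) f.
  by move=> u uts; apply: sf; rewrite inE uts orbT.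
have [nw se ns] := sf t (mem_head _ _).
(* The gluing edge is the south or the west side of [t'], so it can serve as the distinguished edge
   there. *)
have [] := @IHts t' pts' sf' (shared_edge t t').
  case/orP: tt' => /eqP ->; rewrite /shared_edge ?eqxx ?(inj_eq (addrI t)).
    by rewrite !inE eqxx orbT.
  by rewrite mem_head.
move=> n1 n2; rewrite /= {IHts}.
case/orP: tt' => /eqP t'E.
  have [k1 k2 k0] := num_covers_cons pts (or_intror (conj t'E erefl)).
  have fe : f (shared_edge t t') = f (south t).
    by rewrite /shared_edge t'E (inj_eq (addrI t)).
  rewrite k0 n1 n2; move: ee; rewrite !inE => /orP [] /eqP ->.
    by rewrite fe eqxx k2 n2 fe.
  by rewrite fe -nw ns; case: (f (south t)) fe n1 => fe n1 /=; rewrite k1 n1 fe.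
have [k1 k2 k0] := num_covers_cons pts (or_introl (conj t'E erefl)).
have fe : f (shared_edge t t') = f (west t).
  by rewrite /shared_edge t'E eqxx.
rewrite k0 n1 n2; move: ee; rewrite !inE => /orP [] /eqP ->; last first.
  by rewrite fe eqxx k2 n2 fe.
have fs : f (south t) = ~~ f (west t) by rewrite -nw ns negbK.
by rewrite fe fs; case: (f (west t)) fe n1 => fe n1 /=; rewrite k1 n1 fe.
Qed.

Lemma realizes_num_perfect_matchings ts p q : coprime p q -> (0 < q)%N ->
  realizes ts (p%:R / q%:R) -> num_perfect_matchings (snake_graph ts) = p.
Proof.
move=> cpq q0 [sts ts0 [f [e [sf /(sign_frac_of_value cpq q0) c]]]].
case: ts ts0 sts sf c => // t ts _ pts sf c.
rewrite num_perfect_matchingsE -[vertices _]fsetD0 -/(num_covers _ _).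
have [nw _ ns] := sf t (mem_head _ _).
(* South and west have opposite signs, so one of them carries the reference sign [e]. *)
have [e' e't fe'] : exists2 e', e' \in [:: south t; west t] & f e' = e.
  have [<-|ne] := eqVneq (f (south t)) e.
    by exists (south t); rewrite ?mem_head.
  exists (west t); first by rewrite !inE eqxx orbT.
  by rewrite -nw ns; case: (f _) e {c} ne => -[].
by have [] := num_covers_sign_frac pts sf e't; rewrite fe' c.
Qed.

Theorem theorem3p3 (p q a1 : nat) (a : seq nat) (b : seq int)
    (G G' H : seq tile) :
  (0 < p)%N -> (0 < q)%N -> coprime p q ->
  positive_cf (a1 :: a) -> (1 < a1)%N ->
  cfrac [seq n%:Z | n <- a1 :: a] = p%:R / q%:R ->
  even_cf b ->
  cfrac b = p%:R / q%:R \/ cfrac b = p%:R / (p%:R - q%:R) ->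
  positive_snake (a1 :: a) G ->
  positive_snake [:: 1%N, (a1 - 1)%N & a] G' ->
  even_snake b H ->
  [/\ isomorphic (snake_graph G) (snake_graph G'),
      isomorphic (snake_graph G') (snake_graph H)
    & num_perfect_matchings (snake_graph H) = p].
Proof.
move=> p0 q0 cpq pa a1_gt1 cfa eb cfb snG snG' snH.
have rG := positive_snake_realizes pa a1_gt1 snG.
have rG' := positive_snake1_realizes pa a1_gt1 snG'.
(* Values of sign sequences exceed 1, and [p/q] is one of them. *)
have qp : (q < p)%N.
  have [_ _ [f [e [_ v]]]] := rG.
  have := sign_value_gt1 e (map f (interior_edges G)).
  by rewrite v cfa ltr_pdivlMr ?ltr0n // mul1r ltr_nat.
have rH := even_snake_realizes p0 qp eb cfb snH; rewrite -cfa in rH.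
split; [exact: realizes_isomorphic rG rG'|exact: realizes_isomorphic rG' rH|].
by rewrite cfa in rH; exact: realizes_num_perfect_matchings cpq q0 rH.
Qed.
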